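(* For every integer $t\ge 5$, there exists a $K_t$-minor-free graph that is not $\{1\star (t-3),2\}$-choosable.
   Context: All graphs are finite and simple. A graph is $K_t$-minor-free if $K_t$ (the complete graph on $t$ vertices) cannot be obtained from a subgraph of it by contracting edges. A list assignment $L$ of a graph $G$ assigns to each vertex $v$ a set $L(v)$ of colours; an $L$-colouring is a proper colouring $f$ with $f(v)\in L(v)$ for all $v$. For a multiset $\lambda=\{k_1,\dots,k_q\}$ of positive integers, a $\lambda$-list assignment of $G$ is a list assignment $L$ such that the colour set $\bigcup_{v\in V(G)}L(v)$ can be partitioned into $q$ sets $C_1,\dots,C_q$ with $|L(v)\cap C_i|\ge k_i$ for every $i$ and every vertex $v$. $G$ is $\lambda$-choosable if $G$ is $L$-colourable for every $\lambda$-list assignment $L$ of $G$. The notation $a\star m$ inside a multiset means $m$ copies of the integer $a$; thus $\{1\star(t-3),2\}$ consists of $t-3$ copies of $1$ and one copy of $2$. *)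

(* Defs.v *)
From mathcomp Require Import all_boot.
Set Implicit Arguments. Unset Strict Implicit. Unset Printing Implicit Defensive.

Definition simple_graph (V : finType) (e : rel V) : Prop :=
  irreflexive e /\ symmetric e.

Definition induced (V : finType) (e : rel V) (B : {set V}) : rel V :=
  [rel x y | [&& x \in B, y \in B & e x y]].

Definition has_K_minor (V : finType) (e : rel V) (t : nat) : Prop :=
  exists B : 'I_t -> {set V},
    [/\ forall i, B i != set0,
        forall i, {in B i &, forall x y, connect (induced e (B i)) x y},
        forall i j, i != j -> [disjoint B i & B j]
      & forall i j, i != j -> exists x, exists y,
          [/\ x \in B i, y \in B j & e x y]].

Definition K_minor_free (V : finType) (e : rel V) (t : nat) : Prop :=
  ~ has_K_minor e t.

Definition L_colouring (V C : finType) (e : rel V) (L : V -> {set C})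
  (f : V -> C) : Prop :=
  (forall v, f v \in L v) /\ (forall u v, e u v -> f u != f v).

Definition L_colourable (V C : finType) (e : rel V) (L : V -> {set C}) : Prop :=
  exists f : V -> C, L_colouring e L f.

(* lambda = [:: k_1; ...; k_q] (a multiset, listed in any order).
   L is a lambda-list assignment iff the colours can be split into q classes
   C_1..C_q (class of colour c is part c) with |L(v) ∩ C_i| >= k_i. *)
Definition lambda_list_assignment (V C : finType) (lambda : seq nat)
  (L : V -> {set C}) : Prop :=
  exists part : C -> 'I_(size lambda),
    forall (v : V) (i : 'I_(size lambda)),
      nth 0 lambda i <= #|[set c in L v | part c == i]|.

Definition lambda_choosable (V : finType) (e : rel V) (lambda : seq nat) : Prop :=
  forall (C : finType) (L : V -> {set C}),
    lambda_list_assignment lambda L -> L_colourable e L.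

(* Main.v *)
(** One may assume that t - 3 colours are common to all lists, so that every vertex
    has two further private colours.  Take a clique K_{t-1} whose vertices have the
    same list of t - 1 colours: every colouring of it is a bijection onto that list.
    For each such bijection we glue onto the clique a gadget which cannot be coloured
    compatibly with it.  In the gadget, t - 5 clique vertices are joined to everything
    and so only forbid t - 5 common colours; what remains is a fixed planar graph on 17
    vertices which has no list colouring extending the given one.  Gluing along cliques
    of fewer than t vertices does not create K_t minors, and each of the t - 5 dominating
    vertices destroys at most one bag of a minor, so everything reduces to the planar
    graph being K_5-minor-free.  Cutting it along three triangles leaves pieces of at most
    ten vertices, on which a verified search applies. *)

Require Import Defs.
From mathcomp Require Import all_boot all_fingroup.
Set Implicit Arguments. Unset Strict Implicit. Unset Printing Implicit Defensive.

(** * Clique models: clique sums, deletion of vertices, images *)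

Definition clique_model (V I : finType) (e : rel V) (B : I -> {set V}) : Prop :=
  [/\ forall i, B i != set0,
      forall i, {in B i &, forall x y, connect (induced e (B i)) x y},
      forall i j, i != j -> [disjoint B i & B j]
    & forall i j, i != j -> exists x, exists y,
        [/\ x \in B i, y \in B j & e x y]].

Lemma connect_homo (T T' : finType) (r : rel T) (r' : rel T') (f : T -> T') :
  (forall x y, r x y -> connect r' (f x) (f y)) ->
  forall x y, connect r x y -> connect r' (f x) (f y).
Proof.
move=> H x y /connectP[p].
elim: p x => [|z p IHp] x /=; first by move=> _ ->; exact: connect0.
by move=> /andP[/H xz /IHp zp] /zp; exact: connect_trans.
Qed.

Lemma connect_cross (T : finType) (r : rel T) (P : pred T) x y :
  connect r x y -> P x -> ~~ P y -> exists u, exists v, [/\ P u, ~~ P v & r u v].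
Proof.
move=> /connectP[p]; elim: p x => [|z p IHp] x /= .
  by move=> _ -> Px /negP.
move=> /andP[xz zp] yE Px NPy.
case Pz: (P z); first exact: IHp zp yE Pz NPy.
by exists x, z; rewrite Px Pz.
Qed.

Lemma disjoint_family_eq (V I : finType) (B : I -> {set V}) i j x :
  (forall i j, i != j -> [disjoint B i & B j]) -> x \in B i -> x \in B j -> i = j.
Proof.
move=> dB xi xj; apply/eqP; apply/negPn/negP => /dB /disjointFr /(_ xi).
by rewrite xj.
Qed.

(** A point chosen in each bag that meets [K] gives an injection into [K], since the bags are
    disjoint. *)
Lemma card_meeting (V I : finType) (B : I -> {set V}) (K : {set V}) :
  (forall i j, i != j -> [disjoint B i & B j]) ->
  #|[set i | B i :&: K != set0]| <= #|K|.
Proof.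
move=> dB; set J := [set i | _].
have [->|[i0]] := set_0Vmem J; first by rewrite cards0.
rewrite inE => /set0Pn[x0 _].
pose f i := odflt x0 [pick x in B i :&: K].
have fP i : i \in J -> f i \in B i :&: K.
  rewrite inE => /set0Pn[x xK]; rewrite /f.
  by case: pickP => [//|/(_ x)]; rewrite xK.
rewrite -(card_in_imset (f := f)).
  apply: subset_leq_card; apply/subsetP => _ /imsetP[i iJ ->].
  by have := fP i iJ; rewrite inE => /andP[].
move=> i j /fP; rewrite inE => /andP[fi _] /fP; rewrite inE => /andP[fj _] fE.
by apply: disjoint_family_eq dB fi _; rewrite fE.
Qed.

(* A bag stays connected when cut off at the clique [K], because a detour outside can
   be replaced by an edge of [K]; some bag avoids [K] and picks the side [l]. *)
Lemma clique_sum_model (V I : finType) (L : eqType) (e : rel V) (B : I -> {set V})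
    (K : {set V}) (p : V -> L) :
  symmetric e -> {in K &, forall x y, x != y -> e x y} ->
  (forall x y, x \notin K -> y \notin K -> e x y -> p x = p y) ->
  #|K| < #|I| -> clique_model e B ->
  exists l, clique_model e (fun i => B i :&: [set x | (x \in K) || (p x == l)]).
Proof.
move=> sym_e cK pK ltKI [nzB cB dB aB].
have [i0 i0K|noi] := pickP (fun i => B i :&: K == set0); last first.
  have := leq_ltn_trans (card_meeting K dB) ltKI.
  rewrite ltnNge -cardsT subset_leq_card //; apply/subsetP => i _.
  by rewrite inE noi.
(* A bag that misses [K] is connected outside [K], so it stays on one side. *)
have same i x y : B i :&: K == set0 -> x \in B i -> y \in B i -> p x = p y.
  move=> /eqP iK xi yi; apply/eqP/negPn/negP => pxy.
  have pyx : ~~ [pred z | p z == p x] y by rewrite /= eq_sym.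
  have [u [v [/= /eqP pu pv /and3P[ui vi uv]]]] :=
    connect_cross (cB i x y xi yi) (eqxx (p x) : [pred z | p z == p x] x) pyx.
  have NK z : z \in B i -> z \notin K.
    by move=> zi; apply/negP => zK; move/setP/(_ z): iK; rewrite !inE zi zK.
  by move: pv; rewrite -(pK u v) ?NK // pu eqxx.
have [x0 x0i] := set0Pn _ (nzB i0).
exists (p x0); set A := [set x | _].
have i0A x : x \in B i0 -> (x \notin K) && (p x == p x0).
  move=> xi; rewrite (same i0 x x0) // eqxx andbT.
  by apply/negP => xK; move/eqP/setP/(_ x): i0K; rewrite !inE xi xK.
(* Any other bag has an edge to bag [i0], which lies in [A] outside [K]; the far end is in [K] or on
   the same side. *)
have nzA i : exists x, x \in B i :&: A.
  have [->|ii0] := eqVneq i i0.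
    by exists x0; rewrite !inE x0i eqxx orbT.
  have i0i : i0 != i by rewrite eq_sym.
  have [u [v [ui0 vi uv]]] := aB i0 i i0i.
  exists v; rewrite !inE vi /=; case vK: (v \in K) => //=.
  have /andP[uK /eqP <-] := i0A u ui0.
  by rewrite (pK u v) ?vK ?eqxx.
have meetK i x : x \in B i -> x \notin A -> exists2 k, k \in B i & k \in K.
  move=> xi xA; have [iK|/set0Pn[k]] := boolP (B i :&: K == set0); last first.
    by rewrite inE => /andP[ki kK]; exists k.
  have [y] := nzA i; rewrite !inE => /andP[yi yA]; case/negP: xA.
  have yK : y \notin K.
    by apply/negP => yK; move/eqP/setP/(_ y): iK; rewrite !inE yi yK.
  by move: yA; rewrite (negbTE yK) /= inE (same i x y) // => ->; rewrite orbT.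
have crossK x y : e x y -> x \notin A -> (y \in K) || (y \notin A).
  rewrite !inE negb_or => exy /andP[xK px]; case yK: (y \in K) => //=.
  by rewrite -(pK x y) ?yK.
split.
- by move=> i; apply/set0Pn.
- move=> i x y xA yA; move: (xA) (yA); rewrite !in_setI.
  move=> /andP[xi xA'] /andP[yi yA'].
  have [k kA kK] : exists2 k, k \in B i :&: A & (k \in K) || (B i :&: K == set0).
    have [iK|/set0Pn[k]] := boolP (B i :&: K == set0); first by exists x; rewrite ?orbT.
    by rewrite inE => /andP[ki kK]; exists k; rewrite ?inE ?ki kK.
  (* [r] collapses everything outside [A] to [k]. An edge of the bag leaving [A] starts in [K],
     hence at [k] or at a neighbour of [k]; a bag that misses [K] has no such edge. *)
  pose r z := if z \in A then z else k.
  have rE z : z \in A -> r z = z by rewrite /r => ->.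
  rewrite -(rE x) // -(rE y) //; apply: connect_homo (cB i x y xi yi) => u v.
  move=> /and3P[ui vi uv]; rewrite /r.
  have toK z w : e z w -> z \in B i -> w \in B i -> z \notin A -> w \in A ->
      (w == k) || e w k.
    move=> zw zi wi zA wA; have := crossK z w zw zA; rewrite wA orbF => wK.
    have [//|wk /=] := eqVneq w k.
    case/orP: kK => [kK|/eqP/setP/(_ w)]; first exact: cK.
    by rewrite !inE wi wK.
  have kA' : k \in A by move: kA; rewrite in_setI => /andP[].
  have ki : k \in B i by move: kA; rewrite in_setI => /andP[].
  have [uA|uA] := boolP (u \in A); have [vA|vA] := boolP (v \in A).
  + by apply: connect1; rewrite /induced /= !in_setI ui vi uA vA.
  + have := toK v u; rewrite sym_e uv => /(_ isT vi ui vA uA).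
    case/orP => [/eqP->|uk]; first exact: connect0.
    by apply: connect1; rewrite /induced /= !in_setI ui uA ki kA'.
  + have := toK u v uv ui vi uA vA; case/orP => [/eqP->|vk]; first exact: connect0.
    by apply: connect1; rewrite /induced /= !in_setI vi vA ki kA' sym_e.
  + exact: connect0.
- move=> i j /dB; apply: disjointW; exact: subsetIl.
- move=> i j ij.
  (* If the given edge between two bags is not inside [A], both bags meet the clique [K]. *)
  have join u v : u \in B i -> u \in K -> v \in B j -> v \in K ->
      exists x, exists y, [/\ x \in B i :&: A, y \in B j :&: A & e x y].
    move=> ui uK vj vK; exists u, v; split; rewrite ?inE ?ui ?vj ?uK ?vK //.
    apply: cK => //; apply/negP => /eqP uv.
    by move/negP: ij; apply; apply/eqP; apply: disjoint_family_eq dB ui _; rewrite uv.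
  have [x [y [xi yj xy]]] := aB i j ij.
  have [xA|xA] := boolP (x \in A); last first.
    have [k ki kK] := meetK i x xi xA.
    case/orP: (crossK x y xy xA) => [yK|yA]; first exact: join ki kK yj yK.
    by have [k' kj' kK'] := meetK j y yj yA; exact: join ki kK kj' kK'.
  have [yA|yA] := boolP (y \in A); first by exists x, y; rewrite !in_setI xi yj xA yA.
  have [k kj kK] := meetK j y yj yA.
  have := crossK y x; rewrite sym_e xy => /(_ isT yA); rewrite xA orbF => xK.
  exact: join xi xK kj kK.
Qed.

(** At most [#|W|] bags meet [W]; [m] of the others are renumbered. *)
Lemma model_avoiding (V I : finType) (e : rel V) (B : I -> {set V}) (W : {set V}) m :
  clique_model e B -> m + #|W| <= #|I| ->
  exists B' : 'I_m -> {set V}, clique_model e B' /\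
    forall j, exists2 i, B' j = B i & [disjoint B i & W].
Proof.
move=> [nzB cB dB aB] leI.
pose J := [set i | B i :&: W == set0].
have leJ : m <= #|J|.
  have -> : J = ~: [set i | B i :&: W != set0].
    by apply/setP => i; rewrite !inE negbK.
  rewrite -(leq_add2r #|[set i | B i :&: W != set0]|) addnC [X in _ <= X]addnC cardsC.
  by apply: leq_trans leI; rewrite addnC leq_add2l card_meeting.
pose g (j : 'I_m) : I := enum_val (widen_ord leJ j).
have g_inj j k : j != k -> g j != g k.
  apply: contraNneq => /enum_val_inj /(congr1 val) /= /val_inj ->; exact: eqxx.
exists (B \o g); split; last first.
  move=> j; exists (g j) => //.
  by have := enum_valP (widen_ord leJ j); rewrite inE setI_eq0.
split=> [i|i|i j /g_inj|i j /g_inj] /=; [exact: nzB|exact: cB|exact: dB|exact: aB].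
Qed.

(** [f] is controlled only on the bags, so it may take arbitrary values elsewhere. *)
Lemma model_image (V V' I : finType) (e : rel V) (e' : rel V') (f : V -> V')
    (B : I -> {set V}) :
  clique_model e B ->
  (forall i j, {in B i & B j, forall x y, f x = f y -> x = y}) ->
  (forall i j, {in B i & B j, forall x y, e x y -> e' (f x) (f y)}) ->
  clique_model e' (fun i => f @: B i).
Proof.
move=> [nzB cB dB aB] f_inj f_e; split.
- by move=> i; have /set0Pn[x xi] := nzB i; apply/set0Pn; exists (f x); apply: imset_f.
- move=> i _ _ /imsetP[x xi ->] /imsetP[y yi ->].
  apply: connect_homo (cB i x y xi yi) => u v /and3P[ui vi uv].
  by apply: connect1; rewrite /induced /= !imset_f //= (f_e i i).
- move=> i j /dB dij; rewrite disjoints_subset; apply/subsetP => _ /imsetP[x xi ->].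
  rewrite inE; apply/negP => /imsetP[y yj] /(f_inj i j x y xi yj) xy.
  by move: (disjointFr dij xi); rewrite xy yj.
- move=> i j /aB[x [y [xi yj xy]]]; exists (f x), (f y).
  by rewrite !imset_f //; split=> //; exact: (f_e i j).
Qed.

(** * A verified search for clique minors *)

Definition badj (h : rel nat) (v w : seq nat) := has (fun x => has (h x) w) v.

(* [R] lists the connected blocks still to be placed and [F] the bags already
   complete; [k] bags are missing.  The first block of [R] is a complete bag, is
   unused, or shares its bag with an adjacent block of [R]. *)
Fixpoint refute_clique (h : rel nat) (fuel k : nat) (F R : seq (seq nat)) : bool :=
  if k is k'.+1 then
    if (size R < k) || has (fun f => count (badj h f) R < k) F then true
    else if fuel is fuel'.+1 then
      if R is v :: R' then
        [&& if all (badj h v) F then refute_clique h fuel' k' (v :: F) R' else true,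
            refute_clique h fuel' k F R' &
            all (fun w => if badj h v w
                          then refute_clique h fuel' k F (rcons (rem w R') (v ++ w))
                          else true) R']
      else true
    else false
  else false.

Section Refutation.

Variables (N : nat) (I : finType) (h : rel nat) (B : I -> {set 'I_N}).

Let S (w : seq nat) : {set 'I_N} := [set x | val x \in w].

(** Each bag of [J] is sent to the first block satisfying [a] that meets it. A block meeting a bag
    of [J] lies inside it, so this is injective. *)
Lemma card_le_count (a : pred (seq nat)) (J : {set I}) (R : seq (seq nat)) :
  (forall w j, w \in R -> j \in J -> S w \subset B j \/ [disjoint S w & B j]) ->
  (forall i j, i != j -> [disjoint B i & B j]) ->
  (forall j, j \in J -> exists w x, [/\ w \in R, a w, x \in S w & x \in B j]) ->
  #|J| <= count a R.
Proof.
move=> RB dB JR.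
pose m j w := S w :&: B j != set0.
pose W j := nth [::] (filter a R) (find (m j) (filter a R)).
have hasW j : j \in J -> has (m j) (filter a R).
  move=> /JR[w [x [wR aw xw xj]]]; apply/hasP; exists w; first by rewrite mem_filter aw.
  by apply/set0Pn; exists x; rewrite in_setI xw.
have WP j : j \in J -> m j (W j) by move=> /hasW; exact: nth_find.
have WR j : j \in J -> W j \in filter a R by move=> /hasW; rewrite has_find; exact: mem_nth.
rewrite -size_filter cardE -(size_map W); apply: uniq_leq_size; last first.
  by move=> _ /mapP[j + ->]; rewrite mem_enum => /WR.
rewrite map_inj_in_uniq ?enum_uniq // => i j; rewrite !mem_enum => iJ jJ Wij.
have /set0Pn[x] := WP i iJ; rewrite in_setI => /andP[xW xi].
have := WP j jJ; rewrite -Wij /m setI_eq0 => nd.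
have WiR : W i \in R by have := WR i iJ; rewrite mem_filter => /andP[].
case: (RB _ j WiR jJ) => [/subsetP/(_ _ xW) xj|]; last by rewrite (negbTE nd).
exact: disjoint_family_eq dB xi xj.
Qed.

(** Soundness by induction on [fuel]. [J] indexes the missing bags; the invariant is that [F]
    consists of bags outside [J], no bag of [J] splits a block of [R], and the blocks of [R] cover
    these bags. *)
Lemma refute_cliqueP :
  clique_model (fun x y => h (val x) (val y)) B ->
  forall fuel (F R : seq (seq nat)) (J : {set I}),
  refute_clique h fuel #|J| F R ->
  (forall f, f \in F -> exists2 i, i \notin J & S f = B i) ->
  (forall w j, w \in R -> j \in J -> S w \subset B j \/ [disjoint S w & B j]) ->
  (forall j x, j \in J -> x \in B j -> exists2 w, w \in R & x \in S w) -> False.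
Proof.
move=> modB; have [nzB cB dB aB] := modB.
have adjP x y v w : x \in S v -> y \in S w -> h (val x) (val y) -> badj h v w.
  rewrite !inE => xv yw xy; apply/hasP; exists (val x) => //.
  by apply/hasP; exists (val y).
(* Each missing bag owns a block of [R], even one adjacent to any given complete bag. *)
have prune F R (J : {set I}) :
    (forall f, f \in F -> exists2 i, i \notin J & S f = B i) ->
    (forall w j, w \in R -> j \in J -> S w \subset B j \/ [disjoint S w & B j]) ->
    (forall j x, j \in J -> x \in B j -> exists2 w, w \in R & x \in S w) ->
    (size R < #|J|) || has (fun f => count (badj h f) R < #|J|) F = false.
  move=> FB RB BR; apply/negbTE; rewrite negb_or -leqNgt; apply/andP; split.
    rewrite -(count_predT R); apply: card_le_count => // j jJ.
    have /set0Pn[x xj] := nzB j; have [w wR xw] := BR j x jJ xj.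
    by exists w, x.
  apply/hasPn => f fF; rewrite -leqNgt; apply: card_le_count => // j jJ.
  have [i iJ fi] := FB f fF.
  have ij : i != j by apply: contraNneq iJ => ->.
  have [x [y [xi yj xy]]] := aB i j ij.
  have [w wR yw] := BR j y jJ yj; exists w, y; split=> //.
  by apply: adjP yw xy; rewrite fi.
elim=> [|fuel IH] F R J.
  by move=> + FB RB BR; rewrite /=; case cardJ: #|J| => [//|k]; rewrite -cardJ prune.
move=> + FB RB BR; have := prune F R J FB RB BR.
rewrite /=; case cardJ: #|J| => [//|k] ->; case: R RB BR => [|v R] RB BR.
  have [j jJ] : exists j, j \in J by apply/card_gt0P; rewrite cardJ.
  by have /set0Pn[x xj] := nzB j; have [] := BR j x jJ xj.
move=> /and3P[Hfin Hdrop /allP Hmerge].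
have [j /andP[jJ vj]|vout] :=
  pickP (fun j => (j \in J) && ~~ [disjoint S v & B j]); last first.
  move: Hdrop; rewrite -cardJ => /IH; apply=> //.
    by move=> w j wR; apply: RB; rewrite inE wR orbT.
  move=> j x jJ xj; have [w] := BR j x jJ xj; rewrite inE => /orP[/eqP->|wR] xw.
    by move: (vout j); rewrite jJ /= => /negbFE/disjointFr/(_ xw); rewrite xj.
  by exists w.
have [x1 x1v x1j] : exists2 x, x \in S v & x \in B j.
  by move: vj; rewrite -setI_eq0 => /set0Pn[x]; rewrite in_setI => /andP[]; exists x.
have {}vj : S v \subset B j.
  by case: (RB v j _ jJ) vj => [|//|->]; rewrite ?mem_head.
have vB i x : x \in S v -> x \in B i -> i = j.
  by move=> /(subsetP vj) xj xi; exact: disjoint_family_eq dB xi xj.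
have [jv|/subsetPn[y yj yv]] := boolP (B j \subset S v).
  have vE : S v = B j by apply/eqP; rewrite eqEsubset vj.
  have vF : all (badj h v) F.
    apply/allP => f /FB[i iJ fi].
    have ji : j != i by apply: contraNneq iJ => <-.
    by have [x [y [? ? xy]]] := aB j i ji; apply: adjP xy; rewrite ?vE ?fi.
  move: Hfin; rewrite vF; have -> : k = #|J :\ j|.
    by move: cardJ; rewrite (cardsD1 j) jJ => -[].
  move=> /IH; apply.
  - move=> f; rewrite inE => /orP[/eqP->|/FB[i iJ fi]].
      by exists j; rewrite // !inE eqxx.
    by exists i; rewrite // !inE negb_and iJ orbT.
  - by move=> w i wR; rewrite inE => /andP[_ iJ]; apply: RB; rewrite // inE wR orbT.
  - move=> i x; rewrite !inE => /andP[ij iJ] xi.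
    have [w] := BR i x iJ xi; rewrite inE => /orP[/eqP->|wR] xw; last by exists w.
    by move/eqP: ij; case; exact: vB xw xi.
(* The bag is connected and larger than [v], so an edge inside it leaves [v]; the block [w] at the
   far end is merged with [v]. *)
have [u [z [/= uv zv /and3P[uj zj uz]]]] := connect_cross (cB j x1 y x1j yj) x1v yv.
have [w wvR zw] := BR j z jJ zj.
have wR : w \in R.
  by move: wvR; rewrite inE => /predU1P[wv|//]; case/negP: zv; rewrite -wv.
have wj : S w \subset B j.
  by case: (RB w j wvR jJ) => [//|/disjointFr/(_ zw)]; rewrite zj.
have SU : S (v ++ w) = S v :|: S w by apply/setP => q; rewrite !inE mem_cat.
have := Hmerge w wR; rewrite (adjP u z v w) // -cardJ => /IH; apply=> //.
- move=> w' i; rewrite mem_rcons inE => /predU1P[->|w'R] iJ; last first.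
    by apply: RB; rewrite // inE (mem_rem w'R) orbT.
  rewrite SU; have [->|ij] := eqVneq i j; first by left; rewrite subUset vj.
  right; rewrite disjoint_sym; apply: disjointWr (dB i j ij).
  by rewrite subUset vj.
- move=> i q iJ qi; have [w'] := BR i q iJ qi.
  have [-> _ qw|w'w] := eqVneq w' w.
    by exists (v ++ w); rewrite ?mem_rcons ?mem_head // SU inE qw orbT.
  rewrite inE => /predU1P[-> qv|w'R qw'].
    by exists (v ++ w); rewrite ?mem_rcons ?mem_head // SU inE qv.
  by exists w'; rewrite // mem_rcons inE rem_mem // orbT.
Qed.

Lemma refute_clique_free (vs : seq nat) :
  clique_model (fun x y => h (val x) (val y)) B ->
  (forall i x, x \in B i -> val x \in vs) ->
  ~~ refute_clique h (size vs) #|I| [::] [seq [:: v] | v <- vs].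
Proof.
move=> modB Bvs; apply/negP; rewrite -cardsT => /(refute_cliqueP modB); apply=> //.
- move=> _ i /mapP[v _ ->] _.
  have [vi|] := boolP [disjoint S [:: v] & B i]; [by right|].
  rewrite -setI_eq0 => /set0Pn[x]; rewrite !inE => /andP[/eqP xv xi].
  by left; apply/subsetP => y; rewrite !inE -xv => /eqP/val_inj ->.
- move=> j x _ /Bvs xvs; exists [:: val x]; last by rewrite !inE.
  by apply: map_f.
Qed.
End Refutation.

(** * The gadget has no [K_5] minor *)

(* Vertices 0, 1, 2, 3 are the precoloured clique, vertex [i] having colour [i].  The
   triangles 11-12-13 and 14-15-16 form octahedra with 1-5-7 and 2-4-10; they exclude
   that these receive three private colours, because only the two common colours
   would then be left for the inner triangle. *)
Definition gadget_edges : seq (nat * nat) :=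
  [:: (0, 1); (0, 2); (1, 2); (0, 3); (1, 3); (2, 3);
      (0, 4); (0, 7); (1, 5); (1, 7); (1, 9); (2, 4); (2, 6); (2, 9); (2, 10);
      (4, 7); (4, 8); (4, 10); (5, 6); (5, 7); (5, 8); (5, 9);
      (6, 8); (6, 9); (6, 10); (7, 8); (8, 10);
      (1, 11); (7, 11); (7, 12); (5, 12); (1, 13); (5, 13);
      (11, 12); (11, 13); (12, 13);
      (2, 14); (4, 14); (4, 15); (10, 15); (2, 16); (10, 16);
      (14, 15); (14, 16); (15, 16)].

Definition gadget_nbrs : seq (seq nat) := Eval vm_compute in
  [seq [seq y <- iota 0 17 |
          ((x, y) \in gadget_edges) || ((y, x) \in gadget_edges)] | x <- iota 0 17].

Definition gadget : rel nat := fun x y => has (eqn y) (nth [::] gadget_nbrs x).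

Definition gadget_rel : rel 'I_17 := fun x y => gadget x y.

Lemma gadget_sym : symmetric gadget_rel.
Proof.
have ok : all (fun x => all (fun y => gadget x y == gadget y x) (iota 0 17)) (iota 0 17).
  by vm_compute.
move=> x y; have lt17 (z : 'I_17) : val z \in iota 0 17 by rewrite mem_iota /=.
by apply/eqP; exact: (allP (allP ok _ (lt17 x)) _ (lt17 y)).
Qed.

(** [clique_sum_model] with conditions that can be evaluated: [ks] is the separating clique and [q]
    tells the sides apart. *)
Lemma gadget_split (ks : seq nat) (q : pred nat) (B : 'I_5 -> {set 'I_17}) :
  all (fun x => all (fun y => (x != y) ==> gadget x y) ks) ks ->
  all (fun x => all (fun y => [|| x \in ks, y \in ks, ~~ gadget x y | q x == q y])
    (iota 0 17)) (iota 0 17) ->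
  size ks < 5 -> clique_model gadget_rel B ->
  exists l, clique_model gadget_rel
    (fun i => B i :&: [set x : 'I_17 | (val x \in ks) || (q (val x) == l)]).
Proof.
move=> ksK ksq lt5 modB; pose K := [set x : 'I_17 | val x \in ks].
have lt17 (z : 'I_17) : val z \in iota 0 17 by rewrite mem_iota /=.
have [|||l] := clique_sum_model (L := bool) (K := K) (p := fun x => q (val x))
  gadget_sym _ _ _ modB.
- move=> x y; rewrite !inE => xK yK xy.
  by have := allP (allP ksK _ xK) _ yK; rewrite (inj_eq val_inj) xy.
- move=> x y; rewrite !inE => xK yK xy.
  have := allP (allP ksq _ (lt17 x)) _ (lt17 y).
  by rewrite (negbTE xK) (negbTE yK) [gadget _ _]xy => /eqP.
- rewrite card_ord; apply: leq_ltn_trans lt5.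
  rewrite cardE -(size_map val); apply: uniq_leq_size.
    by rewrite map_inj_uniq ?enum_uniq //; exact: val_inj.
  by move=> _ /mapP[x + ->]; rewrite mem_enum inE.
have KE : [set x | (x \in K) || (q (val x) == l)] =
    [set x : 'I_17 | (val x \in ks) || (q (val x) == l)].
  by apply/setP => x; rewrite !inE.
by rewrite KE => modl; exists l.
Qed.

Lemma gadget_K5_free (B : 'I_5 -> {set 'I_17}) : ~ clique_model gadget_rel B.
Proof.
have leaf vs (P : pred nat) (B' : 'I_5 -> {set 'I_17}) :
    refute_clique gadget (size vs) 5 [::] [seq [:: v] | v <- vs] ->
    all (fun m => P m ==> (m \in vs)) (iota 0 17) ->
    clique_model gadget_rel B' -> (forall i x, x \in B' i -> P (val x)) -> False.
  move=> ok Pvs modB' B'P.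
  have Bvs i x : x \in B' i -> val x \in vs.
    by move=> /B'P; apply/implyP/(allP Pvs); rewrite mem_iota /= ltn_ord.
  by have := @refute_clique_free _ _ gadget B' vs modB' Bvs; rewrite card_ord ok.
pose side (ks ks' : seq nat) l m := (m \in ks) || ((m \in ks') == l).
move=> mod0.
(* In the case [true] the model lives in an octahedron; the case [false] discards 11, 12 and 13. The
   next two cuts are alike, with an octahedron and a [K_4] as small sides. *)
have [[] mod1] := @gadget_split [:: 1; 5; 7] (fun m => m \in [:: 11; 12; 13]) B isT isT isT mod0.
  apply: (@leaf [:: 1; 5; 7; 11; 12; 13] (side [:: 1; 5; 7] [:: 11; 12; 13] true))
    mod1 _; [by vm_compute|by vm_compute|].
  by move=> i x /setIP[_]; rewrite in_set.
have [[] mod2] := @gadget_split [:: 2; 4; 10] (fun m => m \in [:: 14; 15; 16]) _ isT isT isT mod1.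
  apply: (@leaf [:: 2; 4; 10; 14; 15; 16] (side [:: 2; 4; 10] [:: 14; 15; 16] true))
    mod2 _; [by vm_compute|by vm_compute|].
  by move=> i x /setIP[_]; rewrite in_set.
have [[] mod3] := @gadget_split [:: 0; 1; 2] (fun m => m \in [:: 3]) _ isT isT isT mod2.
  apply: (@leaf [:: 0; 1; 2; 3] (side [:: 0; 1; 2] [:: 3] true))
    mod3 _; [by vm_compute|by vm_compute|].
  by move=> i x /setIP[_]; rewrite in_set.
(* The ten vertices left after the three cuts; soundness does not depend on their order. *)
apply: (@leaf [:: 10; 6; 2; 9; 1; 0; 4; 5; 8; 7]
  [pred m | [&& side [:: 1; 5; 7] [:: 11; 12; 13] false m,
                side [:: 2; 4; 10] [:: 14; 15; 16] false m &
                side [:: 0; 1; 2] [:: 3] false m]]) mod3 _;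
  [by vm_compute|by vm_compute|].
move=> i x; rewrite !in_setI !in_set => /andP[/andP[/andP[_ x1] x2] x3].
by apply/and3P.
Qed.

(** * List colourings of the gadget *)

(** [s] holds the colours of the first [size s] vertices and [fuel] counts those left, so [false] at
    0 means that an extension was found. *)
Fixpoint no_extension (h : rel nat) (pal : nat -> seq nat) (fuel : nat) (s : seq nat) :
    bool :=
  if fuel is fuel'.+1 then
    all (fun c =>
      if all (fun j => if h j (size s) then nth 0 s j != c else true) (iota 0 (size s))
      then no_extension h pal fuel' (rcons s c) else true) (pal (size s))
  else false.

Lemma no_extensionP (h : rel nat) pal (f : nat -> nat) k fuel :
  (forall m, k <= m < k + fuel -> f m \in pal m) ->
  (forall m m', m < m' < k + fuel -> h m m' -> f m != f m') ->
  ~~ no_extension h pal fuel (mkseq f k).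
Proof.
elim: fuel k => [//|fuel IH] k fpal fh /=; rewrite size_mkseq.
apply/negP => /allP/(_ (f k)); rewrite fpal; last by rewrite leqnn addnS ltnS leq_addr.
move=> /(_ isT); case: ifP => [_|/negP[]].
  rewrite -mkseqS; apply/negP; apply: IH.
    by move=> m /andP[km mk]; apply: fpal; rewrite (ltnW km) -addSnnS.
  by move=> m m'; rewrite addSnnS; exact: fh.
apply/allP => j; rewrite mem_iota /= add0n => jk; case: ifP => // hj.
by rewrite nth_mkseq // fh // jk addnS ltnS leq_addr.
Qed.

(* Colours [0] and [3] are common to all lists, [1], [2], [4] and [5] belong to
   the class in which every vertex has two colours. *)
Definition private_pair (m : nat) : nat * nat :=
  nth (1, 2) [:: (1, 2); (1, 2); (1, 2); (1, 2); (2, 4); (1, 5); (2, 5); (1, 4);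
                 (4, 5); (1, 2); (2, 5); (1, 4); (4, 5); (1, 5); (2, 4); (4, 5); (2, 5)] m.

Definition palette (m : nat) : seq nat :=
  [:: 0; 3; (private_pair m).1; (private_pair m).2].

Lemma gadget_not_extendable : no_extension gadget palette 13 [:: 0; 1; 2; 3].
Proof. by vm_compute. Qed.

(** * Gluing one gadget per permutation onto the base clique *)

Section Construction.

Variable n : nat.

(** For [n] = t - 5 this is the clique on t - 1 vertices. The same type names the colours in its
    lists, so its colourings are permutations. *)
Definition base := ('I_n + 'I_4)%type.
Definition vertex := (base + {perm base} * 'I_13)%type.
Definition colour := ('I_n + 'I_6)%type.

Definition attached (b : base) (u : 'I_13) : bool :=
  match b with inl _ => true | inr k => gadget k (4 + u) end.

(* A base vertex plays in copy [s] of the gadget the role given by its colour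
   when the base is coloured by the permutation [s]. *)
Definition edge : rel vertex := fun x y =>
  match x, y with
  | inl a, inl b => a != b
  | inl a, inr (s, u) | inr (s, u), inl a => attached (s a) u
  | inr (s, u), inr (s', u') => (s == s') && gadget (4 + u) (4 + u')
  end.

(** The value 0 serves all base vertices, as the roles 0 to 3 have the same palette. *)
Definition role (x : vertex) : nat := if x is inr (_, u) then 4 + u else 0.

Definition clist (x : vertex) : {set colour} :=
  [set c | if c is inr k then val k \in palette (role x) else true].

Lemma gadget_ord4_sym (u u' : 'I_13) : gadget (4 + u) (4 + u') = gadget (4 + u') (4 + u).
Proof.
have lt17 (v : 'I_13) : 4 + v < 17 by rewrite (ltn_add2l 4 v 13).
exact: (gadget_sym (Ordinal (lt17 u)) (Ordinal (lt17 u'))).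
Qed.

Lemma edge_simple : simple_graph edge.
Proof.
split=> [[b|[s u]]|[b|[s u]] [b'|[s' u']]] //=.
- by rewrite eqxx.
- rewrite eqxx /=; have ok : all (fun m => ~~ gadget m m) (iota 4 13) by vm_compute.
  by apply/negbTE/(allP ok); rewrite mem_iota leq_addr /= ltn_add2l.
- by rewrite eq_sym.
- by rewrite eq_sym gadget_ord4_sym.
Qed.

Lemma edge_minor_free (B : 'I_(n + 5) -> {set vertex}) : ~ clique_model edge B.
Proof.
move=> modB; have [_ sym_e] := edge_simple.
pose K : {set vertex} := [set x | if x is inl _ then true else false].
pose p (x : vertex) : {perm base} := if x is inr (s, _) then s else 1%g.
have cardK : #|K| = n + 4.
  have -> : K = inl @: [set: base].
    apply/setP => -[b|u]; rewrite !inE; first by rewrite imset_f.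
    by apply/esym/negbTE/negP => /imsetP[].
  by rewrite card_imset ?cardsT ?card_sum ?card_ord // => x y [].
have [|||s mods] := clique_sum_model (K := K) (p := p) sym_e _ _ _ modB.
- by move=> [a|a] [b|b]; rewrite !inE //= => _ _; apply: contraNneq => ->.
- by move=> [a|[s u]] [b|[s' u']]; rewrite !inE //= => _ _ /andP[/eqP].
- by rewrite cardK card_ord ltn_add2l.
(* The base vertices that dominate copy [s]: removing them costs at most [n] of the [n + 5] bags. *)
pose W : {set vertex} :=
  [set x | if x is inl b then if s b is inl _ then true else false else false].
have cardW : #|W| <= n.
  have -> : W = (fun i => inl ((s^-1)%g (inl i))) @: [set: 'I_n].
    apply/setP => -[b|u]; rewrite !inE; last first.
      by apply/esym/negbTE/negP => /imsetP[].
    case sb: (s b) => [i|k].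
      by apply/esym/imsetP; exists i; rewrite ?inE // -sb permK.
    apply/esym/negbTE/negP => /imsetP[i _ [bE]].
    by move: sb; rewrite bE permKV.
  by apply: leq_trans (leq_imset_card _ _) _; rewrite cardsT card_ord.
have [|B' [modB' B'B]] := model_avoiding (W := W) (m := 5) mods.
  by rewrite card_ord addnC leq_add2r.
have B'P j x : x \in B' j ->
    match x with inl b => if s b is inl _ then false else true | inr (s', _) => s' == s end.
  have [i -> dW] := B'B j => xi; move: (disjointFr dW xi); move: xi.
  rewrite in_setI in_set => /andP[_]; rewrite !inE.
  by case: x => [b|[s' u]] //= _; case: (s b).
pose f (x : vertex) : 'I_17 :=
  match x with
  | inl b => if s b is inr k then inord k else ord0
  | inr (_, u) => inord (4 + u)
  end.
have lt4 (k : 'I_4) : k < 17 by apply: ltn_trans (ltn_ord k) _.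
have lt13 (u : 'I_13) : 4 + u < 17 by rewrite (ltn_add2l 4 u 13).
apply: (@gadget_K5_free (fun i => f @: B' i)); apply: model_image modB' _ _.
- move=> i j x y /B'P + /B'P; case: x y => [b|[s1 u]] [b'|[s2 u']] /=.
  + case sb: (s b) => [//|k]; case sb': (s b') => [//|k'] _ _ /(congr1 val).
    rewrite /= !inordK // => /val_inj kk.
    by congr inl; apply: (@perm_inj _ s); rewrite sb sb' kk.
  + case: (s b) => [//|k] _ _ /(congr1 val); rewrite /= !inordK //= => kE.
    by have := ltn_ord k; rewrite kE.
  + case: (s b') => [//|k] _ _ /(congr1 val); rewrite /= !inordK //= => kE.
    by have := ltn_ord k; rewrite -kE.
  + by move=> /eqP-> /eqP-> /(congr1 val); rewrite /= !inordK // => /addnI/val_inj ->.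
- have base_clique : all (fun k => all (fun l => (k != l) ==> gadget k l) (iota 0 4)) (iota 0 4).
    by [].
  move=> i j x y /B'P + /B'P; case: x y => [b|[s1 u]] [b'|[s2 u']] /=.
  + case sb: (s b) => [//|k]; case sb': (s b') => [//|k'] _ _ bb'.
    rewrite /gadget_rel !inordK //.
    have k4 (l : 'I_4) : val l \in iota 0 4 by rewrite mem_iota /=.
    apply: (implyP (allP (allP base_clique _ (k4 k)) _ (k4 k'))).
    by apply: contraNneq bb' => /val_inj kk; apply/eqP/(@perm_inj _ s); rewrite sb sb' kk.
  + case sb: (s b) => [//|k] _ /eqP->; by rewrite sb /= /gadget_rel !inordK.
  + case sb: (s b') => [//|k] /eqP-> _; by rewrite sb /= gadget_sym /gadget_rel !inordK.
  + by move=> _ _ /andP[_]; rewrite /gadget_rel !inordK.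
Qed.

Lemma edge_not_colourable : ~ L_colourable edge clist.
Proof.
move=> [f [fL fe]].
(* Base lists contain only the [inl] colours and 0 to 3, so [inord] is applied there below 4. *)
pose lower (c : colour) : base := match c with inl i => inl i | inr k => inr (inord k) end.
pose raise (b : base) : colour :=
  match b with inl i => inl i | inr k => inr (widen_ord (isT : 4 <= 6) k) end.
have lowerK b : raise (lower (f (inl b))) = f (inl b).
  have := fL (inl b); rewrite inE; case: (f (inl b)) => [//|k] /= k4.
  congr inr; apply: val_inj => /=; rewrite inordK //.
  by move: k4; rewrite !inE => /or4P[] /eqP->.
have g_inj : injective (fun b => lower (f (inl b))).
  move=> b b' /(congr1 raise); rewrite !lowerK => fbb'.
  by apply/eqP/negPn/negP => /(fe (inl b) (inl b')); rewrite fbb' eqxx.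
(* In copy [s] the base vertex coloured [b] plays the role [b]; this copy gives the
   contradiction. *)
pose s := perm g_inj.
have fbase b : f (inl ((s^-1)%g b)) = raise b.
  by rewrite -lowerK; congr raise; rewrite -(permE g_inj) permKV.
have fs b u : attached b u -> f (inr (s, u)) != raise b.
  move=> bu; rewrite -fbase; apply: fe.
  by rewrite /= permKV.
(* The dominating base vertices use up all [inl] colours. *)
have fsr u : exists2 k : 'I_6, f (inr (s, u)) = inr k & val k \in palette (4 + u).
  have := fL (inr (s, u)); rewrite inE; case fu: (f _) => [i|k] /= H; last by exists k.
  by have := fs (inl i) u isT; rewrite fu eqxx.
(* The induced colouring of the gadget; by [fsr] the default 0 never occurs. *)
pose F m := if m < 4 then m else
  if f (inr (s, inord (m - 4))) is inr k then val k else 0.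
have F4 (m : nat) : 4 <= m < 17 -> exists u : 'I_13, exists k : 'I_6,
    [/\ m = 4 + u, f (inr (s, u)) = inr k & F m = k].
  move=> /andP[m4 m17]; have [k fk _] := fsr (inord (m - 4)).
  exists (inord (m - 4)), k; split=> //; last by rewrite /F ltnNge m4 fk.
  by rewrite inordK ?subnKC // ltn_subLR.
have := @no_extensionP gadget palette F 4 13; rewrite gadget_not_extendable.
move=> H; suff: ~~ true by []; apply: H => {lowerK}.
- move=> m mI; have [u [k [-> fk ->]]] := F4 m mI.
  by have [k' fk'] := fsr u; move: fk'; rewrite fk => -[->].
- move=> m m' /andP[mm' m'17].
  have [m'4|m'4] := ltnP m' 4.
    by rewrite /F m'4 (ltn_trans mm' m'4) neq_ltn mm'.
  have [|u' [k' [m'E fk' ->]]] := F4 m'; first by rewrite m'4.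
  have [m4|m4] := ltnP m 4.
    rewrite {1}/F m4 m'E => mu; have := fs (inr (Ordinal m4)) u' mu.
    rewrite fk'; apply: contraNneq => kE.
    by apply/eqP; congr inr; apply: val_inj; rewrite /= -kE.
  have [|u [k [mE fk ->]]] := F4 m; first by rewrite m4 (ltn_trans mm').
  rewrite mE m'E => uu'.
  have := fe (inr (s, u)) (inr (s, u')); rewrite /= eqxx fk fk' => /(_ uu').
  by apply: contraNneq => kk; apply/eqP; congr inr; apply: val_inj.
Qed.

Lemma clist_lambda : lambda_list_assignment (nseq (n + 2) 1 ++ [:: 2]) clist.
Proof.
have sizeE : size (nseq (n + 2) 1 ++ [:: 2]) = n + 3.
  by rewrite size_cat size_nseq -addnA.
(* Colours 0 and 3 form the classes [n] and [n + 1]; the default 2 of [nth] puts 4 and 5 with 1 and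
   2 into class [n + 2]. *)
pose cls (c : colour) : nat :=
  match c with inl i => i | inr k => n + nth 2 [:: 0; 2; 2; 1] k end.
have cls_lt c : cls c < size (nseq (n + 2) 1 ++ [:: 2]).
  rewrite sizeE; case: c => [i|k] /=; first by apply: ltn_addr.
  by rewrite ltn_add2l; case: k => -[|[|[|[|[|[]]]]]].
exists (fun c => Ordinal (cls_lt c)) => v [i i_lt].
rewrite [X in nth 0 _ X]/=.
pose c_ (k : nat) : colour := inr (inord k).
have c_in (k : nat) : k < 6 -> k \in palette (role v) -> n + nth 2 [:: 0; 2; 2; 1] k == i ->
    c_ k \in [set c in clist v | Ordinal (cls_lt c) == Ordinal i_lt].
  by move=> k6 kp kE; rewrite !inE /= -val_eqE /= inordK // kp.
have [i2|i2] := ltnP i (n + 2); rewrite nth_cat size_nseq.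
  rewrite i2 nth_nseq i2; apply/card_gt0P.
  have [i_n|] := ltnP i n.
    by exists (inl (Ordinal i_n)); rewrite !inE /= -val_eqE.
  rewrite leq_eqVlt => /predU1P[iE|n_i].
    by exists (c_ 0); apply: c_in; rewrite ?inE //= addn0 iE.
  exists (c_ 3); apply: c_in; rewrite ?inE //= addn1.
  by rewrite eqn_leq n_i -ltnS -addn2.
have iE : n + 2 == i.
  by rewrite eqn_leq i2 -ltnS -addnS -sizeE.
rewrite ltnNge i2 /= -[X in X - (n + 2)](eqP iE) subnn; apply/card_gt1P.
set q := private_pair (role v).
have /and3P[q1 q2 q12] : [&& q.1 \in [:: 1; 2; 4; 5], q.2 \in [:: 1; 2; 4; 5] & q.1 != q.2].
  have ok : all (fun m => [&& (private_pair m).1 \in [:: 1; 2; 4; 5],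
      (private_pair m).2 \in [:: 1; 2; 4; 5] & (private_pair m).1 != (private_pair m).2])
      (iota 0 17) by [].
  apply: (allP ok); rewrite mem_iota /=.
  by case: (v) => [//|[s u]] /=; rewrite (ltn_add2l 4 u 13).
have q6 k : k \in [:: 1; 2; 4; 5] -> k < 6 /\ nth 2 [:: 0; 2; 2; 1] k = 2.
  by rewrite !inE => /or4P[] /eqP->.
have [[lt1 n1] [lt2 n2]] := (q6 _ q1, q6 _ q2).
exists (c_ q.1), (c_ q.2); split.
- by apply: c_in; rewrite ?n1 // !inE eqxx !orbT.
- by apply: c_in; rewrite ?n2 // !inE eqxx !orbT.
- by apply: contra q12 => /eqP[] /(congr1 val); rewrite /= !inordK // => ->.
Qed.

End Construction.

Theorem theorem1 :
  forall t : nat, 5 <= t ->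
    exists (n : nat) (e : rel 'I_n),
      [/\ simple_graph e, K_minor_free e t
        & ~ lambda_choosable e (nseq (t - 3) 1 ++ [:: 2])].
Proof.
move=> t t5; pose n := t - 5.
have tE : t = n + 5 by rewrite subnK.
have -> : t - 3 = n + 2 by rewrite tE -addnBA.
rewrite {}tE; have [irr sym] := edge_simple n.
(* Vertices are renumbered by enumeration: bags are pushed along [enum_val], colourings pulled back
   along [enum_rank]. *)
exists #|{: vertex n}|, (fun i j => edge (enum_val i) (enum_val j)); split.
- by split=> [i|i j]; [exact: irr|exact: sym].
- move=> [B modB]; apply: (@edge_minor_free n (fun i => enum_val @: B i)).
  apply: (model_image (modB : clique_model _ B)) => i j x y _ _ //.
  exact: enum_val_inj.
- move=> /(_ (colour n) (fun i => clist (enum_val i)))[|f [fL fe]].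
    have [part partP] := clist_lambda n.
    by exists part => i; exact: partP.
  apply: (@edge_not_colourable n); exists (f \o enum_rank); split=> [v|u v uv] /=.
    by have := fL (enum_rank v); rewrite enum_rankK.
  by apply: fe; rewrite !enum_rankK.
Qed.
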